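(* Let $X\subset\mathbb R^n$ be compact and denote $B_X:=\sup_{x\in X}\|x\|_2$. Suppose that $\Theta\subseteq\mathbb R^{n+1}$, with elements written $\theta=(w,b)$, $w\in\mathbb R^n$, $b\in\mathbb R$, and that the feature map factorizes as $\Phi(x,\theta)=\phi(w^{\mathsf T}x+b)M(w)$ for some $M:\mathbb R^n\to\mathbb R^{d\times d_1}$ and a $1$-Lipschitz scalar function $\phi:\mathbb R\to[-1,1]$. Let $B_h>0$ and let $h\in\mathcal F_2(B_h)$ with representing density $\alpha$, i.e. $h(\cdot)=\int_\Theta\Phi(\cdot,\theta)\alpha(\theta)d\nu(\theta)$ with $\operatorname{ess\,sup}_{\theta}\|\alpha(\theta)\|_2\le B_h$. Let $K$ be a positive integer and let $\theta_i=(w_i,b_i)$, $i=1,\dots,K$, be i.i.d. draws from $\nu$. Then for any $\eta\in(0,1)$, $$\frac2K\,\mathbb E\Big\|\sum_{i=1}^K\varepsilon_i\Phi_\eta(\cdot;\theta_i)\alpha(\theta_i)\Big\|_\infty\le\frac{4B_hB_\Phi(\eta)}{\sqrt K}\Big[B_X\sqrt{\mathbb E\|w_1\|_2^2}+\sqrt{d_1}\Big].$$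
   Context: $\Theta$ is a measurable space with a probability measure $\nu$, and $\Phi:\mathbb R^n\times\Theta\to\mathbb R^{d\times d_1}$ with $d_1\le d$. $\|\cdot\|_{\mathrm{op}}$ is the $\ell_2\to\ell_2$ operator norm and $\|f\|_\infty:=\sup_{x\in X}\|f(x)\|_2$. For $B>0$, $\mathcal F_2(B)$ is the set of functions $f(\cdot)=\int_\Theta\Phi(\cdot,\theta)\alpha(\theta)d\nu(\theta)$ with $\alpha:\Theta\to\mathbb R^{d_1}$ and $\operatorname{ess\,sup}_{\theta}\|\alpha(\theta)\|_2\le B$. The $\varepsilon_i$ are i.i.d. Rademacher random variables ($\pm1$ with probability $1/2$ each), independent of the $\theta_i$; the expectation is over all $\varepsilon_i,\theta_i$. $B_\Phi$ is any function on $(0,1)$ satisfying $\mathbb P_{\theta\sim\nu}(\|M(w)\|_{\mathrm{op}}>B_\Phi(\delta))\le\delta$ for every $\delta\in(0,1)$. For $\eta\in(0,1)$, $M_\eta(w):=M(w)\mathbf 1\{\|M(w)\|_{\mathrm{op}}\le B_\Phi(\eta)\}$ and $\Phi_\eta(x,\theta)=M_\eta(w)\phi(w^{\mathsf T}x+b)$. *)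

(* Defs.v *)
From HB Require Import structures.
From mathcomp Require Import all_boot all_order all_algebra.
From mathcomp Require Import all_classical all_reals all_analysis.
From mathcomp Require Import ess_sup_inf.

Set Implicit Arguments.
Unset Strict Implicit.
Unset Printing Implicit Defensive.

Import Order.TTheory GRing.Theory Num.Theory.
Import numFieldNormedType.Exports.

Local Open Scope classical_set_scope.
Local Open Scope ring_scope.

Section norms.
Context {R : realType}.

(* The library norm on matrices is the max norm, hence this definition. *)
Definition l2norm n (v : 'cV[R]_n) : R := Num.sqrt (\sum_(i < n) v i 0 ^+ 2).

Definition opnorm m n (A : 'M[R]_(m, n)) : R :=
  sup [set l2norm (A *m u) | u in [set u : 'cV[R]_n | l2norm u <= 1]].

Definition supnorm n d (X : set 'cV[R]_n) (f : 'cV[R]_n -> 'cV[R]_d) : \bar R :=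
  ereal_sup [set (l2norm (f x))%:E | x in X].

Definition set_radius n (X : set 'cV[R]_n) : \bar R :=
  ereal_sup [set (l2norm x)%:E | x in X].

End norms.

(* Borel measurability of matrix-valued maps is entrywise measurability. *)
Definition mx_measurable {dT : measure_display} {T : measurableType dT}
    {R : realType} m n (f : T -> 'M[R]_(m, n)) : Prop :=
  forall i j, measurable_fun [set: T] (fun t => f t i j).

Section function_class.
Context {dT : measure_display} {Theta : measurableType dT} {R : realType}.
Variable nu : probability Theta R.
Variables (n d d1 : nat) (Phi : 'cV[R]_n -> Theta -> 'M[R]_(d, d1)).

Definition F2_density (B : R) (alpha : Theta -> 'cV[R]_d1)
    (f : 'cV[R]_n -> 'cV[R]_d) : Prop :=
  [/\ mx_measurable alpha,
      (ess_sup nu (fun t => (l2norm (alpha t))%:E) <= B%:E)%E &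
      forall x i,
        nu.-integrable [set: Theta] (fun t => ((Phi x t *m alpha t) i 0)%:E) /\
        f x i 0 = \int[nu]_t ((Phi x t *m alpha t) i 0)].

Definition F2 (B : R) : set ('cV[R]_n -> 'cV[R]_d) :=
  [set f | exists alpha, F2_density B alpha f].

End function_class.

Section independence.
Context {dO : measure_display} {Omega : measurableType dO} {R : realType}.
Variable P : probability Omega R.

Definition mutually_independent {dT : measure_display} {T : measurableType dT}
    (I : finType) (Y : I -> {RV P >-> T}) : Prop :=
  forall (J : {set I}) (A : I -> set T), (forall i, measurable (A i)) ->
    P (\bigcap_(i in [set` J]) (Y i @^-1` A i)) =
    (\prod_(i in J) P (Y i @^-1` A i))%E.

Definition iid {dT : measure_display} {T : measurableType dT}
    (I : finType) (mu : probability T R) (Y : I -> {RV P >-> T}) : Prop :=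
  mutually_independent Y /\
  forall i A, measurable A -> distribution P (Y i) A = mu A.

Definition sigma_family {dT : measure_display} {T : measurableType dT}
    (I : finType) (Y : I -> {RV P >-> T}) : set (set Omega) :=
  <<s [set S | exists i A, measurable A /\ S = Y i @^-1` A] >>.

Definition independent_families
    {dT dU : measure_display} {T : measurableType dT} {U : measurableType dU}
    (I J : finType) (Y : I -> {RV P >-> T}) (Z : J -> {RV P >-> U}) : Prop :=
  forall A B, sigma_family Y A -> sigma_family Z B ->
    P (A `&` B) = (P A * P B)%E.

Definition rademacher (e : {RV P >-> R}) : Prop :=
  P (e @^-1` [set 1]) = (2^-1)%:E /\ P (e @^-1` [set -1]) = (2^-1)%:E.

End independence.

Section truncation.
Context {R : realType}.
Variables (n d d1 : nat) (M : 'cV[R]_n -> 'M[R]_(d, d1)) (BPhi : R -> R).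

Definition trunc_mx (eta : R) (w : 'cV[R]_n) : 'M[R]_(d, d1) :=
  if opnorm (M w) <= BPhi eta then M w else 0.

Definition trunc_feature {Theta : Type} (w : Theta -> 'cV[R]_n) (b : Theta -> R)
    (phi : R -> R) (eta : R) (x : 'cV[R]_n) (t : Theta) : 'M[R]_(d, d1) :=
  phi (((w t)^T *m x) 0 0 + b t) *: trunc_mx eta (w t).

End truncation.

(* Main.v *)
Require Import Defs.
From HB Require Import structures.
From mathcomp Require Import all_boot all_order all_algebra.
From mathcomp Require Import all_classical all_reals all_analysis.
From mathcomp Require Import measurable_realfun ess_sup_inf.
From mathcomp Require Import ring lra.

(** Write [v_i] for the vector [M_eta(w_i) alpha(theta_i)], whose norm is almost
surely at most [V := Bh * BPhi eta]; the [i]-th term of the process is then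
[eps_i phi(w_i . x + b_i) v_i].  By duality of the Euclidean norm, the norm of
the sum is the supremum over the unit ball of
[sum_i eps_i phi(w_i . x + b_i) (u . v_i)], a Rademacher process indexed by
[z = (x, u)] that is not linear in [z].  Since [phi] is 1-Lipschitz and bounded
by 1, the increments of its [i]-th coordinate are dominated by the sum of the
increments of the two linear coordinates [V (w_i . x)] and [u . v_i].

The heart of the proof is a contraction principle for such a domination
([sum_finmax_two_signs] for one index, [sum_finmax_tensor] for all of them):
the process is bounded by twice the linear process
[sum_i eps_i V (w_i . x) + eps'_i (u . v_i)], at the price of a second
independent family of signs [eps'].  The two signs come from the elementary fact
that [|G| + |K| <= |G + K| + |G - K|].  A linear Rademacher process indexed by a
ball is bounded by Cauchy-Schwarz and orthogonality of the signs
([sum_rademacher_linear]), so that for fixed parameters the average over the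
signs is at most [2 (V BX sqrt(sum_i |w_i|^2) + sqrt(sum_i |v_i|^2))]
([sum_signs_neuron]).  The factor 2 of the contraction and the factor [2 / K] of
the statement make up the constant 4.

The suprema need no care in this deterministic part: an average over finitely
many sign vectors of suprema is the supremum, over all choices of one point per
sign vector, of the averages ([sum_ereal_sup_le]), and for one such choice the
index set of the process can be replaced by the finite set of sign vectors.

In the probabilistic part, the event that the signs take given values has
probability [2^-K] and is independent of the parameters, so that the expectation
is that of the average over the signs ([integral_signs]).  This uses that the
supremum over [X] is a measurable function of the parameters, which holds because
it may be taken over a countable dense subset ([measurable_sup_continuous]).
Jensen's inequality for the square root ([integral_sqrt_le]) and equality of the
laws of the [w_i] conclude.  The factor [sqrt d1] is only compared with 1, except
that for [d1 = 0] both the vectors [v_i] and this factor vanish. *)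

Set Implicit Arguments.
Unset Strict Implicit.
Unset Printing Implicit Defensive.

Import Order.TTheory GRing.Theory Num.Theory.
Import numFieldNormedType.Exports.

Local Open Scope classical_set_scope.
Local Open Scope ring_scope.

(** * Euclidean norms *)

Section euclid.
Context {R : realType}.

Lemma cauchy_schwarz_sum (I : finType) (a b : I -> R) :
  \sum_i a i * b i <=
  Num.sqrt (\sum_i a i ^+ 2) * Num.sqrt (\sum_i b i ^+ 2).
Proof.
set p := \sum_i a i ^+ 2; set q := \sum_i b i ^+ 2; set m := \sum_i _.
have p0 : 0 <= p by apply: sumr_ge0 => i _; exact: sqr_ge0.
have q0 : 0 <= q by apply: sumr_ge0 => i _; exact: sqr_ge0.
(* The claim is that the discriminant of this nonnegative form is at most 0. *)
have quad x y : 0 <= x ^+ 2 * p - 2 * (x * y) * m + y ^+ 2 * q.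
  have -> : x ^+ 2 * p - 2 * (x * y) * m + y ^+ 2 * q =
            \sum_i (x * a i - y * b i) ^+ 2.
    rewrite /p /q /m !mulr_sumr -sumrB -big_split /=.
    by apply: eq_bigr => i _; ring.
  by apply: sumr_ge0 => i _; exact: sqr_ge0.
have mpq : m ^+ 2 <= p * q.
  have [p_gt0|p_le0] := ltP 0 p.
    have := quad m p; have -> : m ^+ 2 * p - 2 * (m * p) * m + p ^+ 2 * q =
      p * (p * q - m ^+ 2) by ring.
    by rewrite pmulr_rge0// subr_ge0.
  have p_eq0 : p = 0 by apply/eqP; rewrite eq_le p_le0 p0.
  (* For p = 0 a vector along which the form is negative unless m = 0. *)
  have := quad (m * (q + 1)) (m ^+ 2); rewrite p_eq0.
  have -> : (m * (q + 1)) ^+ 2 * 0 - 2 * (m * (q + 1) * m ^+ 2) * m +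
     m ^+ 2 ^+ 2 * q = - ((m ^+ 2) ^+ 2 * (q + 2)) by ring.
  rewrite oppr_ge0 pmulr_lle0; last by rewrite ltr_wpDl.
  move=> m4; have : m ^+ 2 ^+ 2 == 0 by rewrite eq_le m4 sqr_ge0.
  by rewrite !sqrf_eq0 => /eqP ->; rewrite expr0n mul0r.
rewrite -sqrtrM//; apply: le_trans (ler_norm m) _.
by rewrite -sqrtr_sqr; exact: ler_wsqrtr.
Qed.

Lemma dotE n (u v : 'cV[R]_n) : (u^T *m v) 0 0 = \sum_i u i 0 * v i 0.
Proof. by rewrite mxE; apply: eq_bigr => i _; rewrite mxE. Qed.

Lemma l2norm_ge0 n (u : 'cV[R]_n) : 0 <= l2norm u.
Proof. exact: sqrtr_ge0. Qed.

Lemma sqr_l2norm n (u : 'cV[R]_n) : l2norm u ^+ 2 = \sum_i u i 0 ^+ 2.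
Proof. by rewrite sqr_sqrtr// sumr_ge0// => i _; exact: sqr_ge0. Qed.

Lemma l2norm0 n : l2norm (0 : 'cV[R]_n) = 0.
Proof.
rewrite /l2norm big1 ?sqrtr0// => i _.
by rewrite mxE expr0n.
Qed.

Lemma l2norm_eq0 n (u : 'cV[R]_n) : l2norm u = 0 -> u = 0.
Proof.
move=> u0; have /psumr_eq0P : \sum_i u i 0 ^+ 2 = 0.
  by rewrite -sqr_l2norm u0 expr0n.
move=> u_eq0; apply/matrixP => i j; rewrite ord1 mxE; apply/eqP.
by rewrite -sqrf_eq0 u_eq0// => k _; exact: sqr_ge0.
Qed.

Lemma l2normZ n c (u : 'cV[R]_n) : l2norm (c *: u) = `|c| * l2norm u.
Proof.
rewrite /l2norm -sqrtr_sqr -sqrtrM ?sqr_ge0// mulr_sumr.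
by congr Num.sqrt; apply: eq_bigr => i _; rewrite mxE exprMn.
Qed.

Lemma cauchy_schwarz n (u v : 'cV[R]_n) :
  (u^T *m v) 0 0 <= l2norm u * l2norm v.
Proof. by rewrite dotE; exact: cauchy_schwarz_sum. Qed.

Lemma l2norm_dual n (v : 'cV[R]_n) :
  exists2 u : 'cV[R]_n, l2norm u <= 1 & (u^T *m v) 0 0 = l2norm v.
Proof.
have [v0|v0] := eqVneq (l2norm v) 0.
  exists 0; first by rewrite l2norm0.
  by rewrite v0 dotE big1// => i _; rewrite mxE mul0r.
exists ((l2norm v)^-1 *: v).
  by rewrite l2normZ ger0_norm ?invr_ge0 ?l2norm_ge0// mulVf.
rewrite dotE (eq_bigr (fun i => (l2norm v)^-1 * v i 0 ^+ 2)); last first.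
  by move=> i _; rewrite mxE -mulrA expr2.
by rewrite -mulr_sumr -sqr_l2norm expr2 mulKf.
Qed.

End euclid.

(** * Contraction of Rademacher processes *)

Section finite_max.
Context {R : realType} {Z : finType}.
Variable z0 : Z.
Implicit Types F G : Z -> R.

Definition finmax F : R := F [arg max_(z > z0) F z]%O.

Lemma finmax_ge F z : F z <= finmax F.
Proof. by rewrite /finmax; case: arg_maxP => // y _ /(_ z); exact. Qed.

Lemma finmax_attained F : exists z, finmax F = F z.
Proof. by eexists. Qed.

Lemma eq_finmax F G : F =1 G -> finmax F = finmax G.
Proof. by move=> /funext ->. Qed.

End finite_max.

Section resampling.
Context {R : realType} {I T : finType}.

Definition resample (s : {ffun I -> T}) (i : I) (t : T) : {ffun I -> T} :=
  [ffun j => if j == i then t else s j].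

(** Averages over independent coordinates are unchanged when one coordinate is
drawn afresh: exchanging the fresh value with the old one is an involution. *)
Lemma sum_resample (F : {ffun I -> T} -> R) (i : I) :
  \sum_s \sum_t F (resample s i t) = #|T|%:R * \sum_s F s.
Proof.
rewrite pair_big/=.
pose h (p : {ffun I -> T} * T) := (resample p.1 i p.2, p.1 i).
have hK : involutive h.
  move=> [s t]; rewrite /h /=; congr pair; last by rewrite ffunE eqxx.
  by apply/ffunP => j; rewrite !ffunE; case: eqP => // ->.
rewrite (reindex_inj (inv_inj hK)) /=.
rewrite (eq_bigr (fun p : {ffun I -> T} * T => F p.1)); last first.
  move=> [s t] _ /=; congr F; apply/ffunP => j.
  by rewrite !ffunE; case: eqP => // ->.
rewrite -(pair_big xpredT xpredT (fun s (t : T) => F s)) /= mulr_sumr.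
by apply: eq_bigr => s _; rewrite sumr_const mulr_natl.
Qed.

(** A comparison of expected maxima that holds for one random coordinate, whatever
deterministic function [A] is added, holds for a sum over independent coordinates:
the coordinates are replaced one at a time, the others being frozen in [A]. *)
Lemma sum_finmax_tensor {Z : finType} (z0 : Z) (a b : I -> T -> Z -> R) :
  (0 < #|T|)%N ->
  (forall i (A : Z -> R), \sum_t finmax z0 (fun z => A z + a i t z) <=
                          \sum_t finmax z0 (fun z => A z + b i t z)) ->
  \sum_(s : {ffun I -> T}) finmax z0 (fun z => \sum_i a i (s i) z) <=
  \sum_(s : {ffun I -> T}) finmax z0 (fun z => \sum_i b i (s i) z).
Proof.
move=> T_gt0 ab.
(* The indices in l are those already replaced. *)
pose c (l : seq I) i := if i \in l then b i else a i.
pose S l := \sum_(s : {ffun I -> T}) finmax z0 (fun z => \sum_i c l i (s i) z).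
suff hS l : uniq l -> S [::] <= S l.
  have := hS _ (enum_uniq I); rewrite /S /c.
  by under [X in _ <= X -> _]eq_bigr do
    under eq_finmax do under eq_bigr do rewrite mem_enum.
elim: l => // j l IH /= /andP[jl ul]; apply: le_trans (IH ul) _.
have T0 : 0 < #|T|%:R :> R by rewrite ltr0n.
rewrite -(ler_pM2l T0) /S -!(sum_resample _ j); apply: ler_sum => s _.
pose A z := \sum_(i | i != j) c l i (s i) z.
rewrite (eq_bigr (fun t => finmax z0 (fun z => A z + a j t z))); last first.
  move=> t _; apply: eq_finmax => z; rewrite (bigD1 j)//= addrC /c (negbTE jl).
  rewrite ffunE eqxx; congr +%R; apply: eq_bigr => i ij.
  by rewrite ffunE (negbTE ij).
apply: le_trans (ab _ _) _; apply: ler_sum => t _.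
rewrite le_eqVlt; apply/orP; left; apply/eqP.
apply: eq_finmax => z; rewrite (bigD1 j)//= addrC /c inE eqxx /=.
rewrite ffunE eqxx; congr +%R; apply: eq_bigr => i ij.
by rewrite ffunE (negbTE ij) inE (negbTE ij).
Qed.

Lemma sum_ffun_orthogonal (sg : T -> R) (i j : I) :
  (0 < #|T|)%N -> \sum_t sg t = 0 -> (forall t, sg t ^+ 2 = 1) ->
  \sum_(s : {ffun I -> T}) sg (s i) * sg (s j) =
    (i == j)%:R * #|{ffun I -> T}|%:R.
Proof.
move=> T_gt0 sg0 sg1; have [->|ij] := eqVneq i j.
  under eq_bigr do rewrite -expr2 sg1.
  by rewrite sumr_const mul1r.
have T0 : #|T|%:R != 0 :> R by rewrite pnatr_eq0 -lt0n.
apply: (mulfI T0); rewrite mul0r mulr0 -(sum_resample _ i) big1// => s _.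
under eq_bigr do rewrite !ffunE eqxx eq_sym (negbTE ij).
by rewrite -mulr_suml sg0 mul0r.
Qed.

(** A linear process is controlled by the norm of [sum_i sg_i w_i] through
Cauchy-Schwarz, and orthogonality of centered independent signs makes the mean
square of this norm equal to [sum_i |w_i|^2].  The signs are a function [sg] of
the coordinate in [T] so that either component of a pair of signs can be used. *)
Lemma sum_rademacher_linear n (w : I -> 'cV[R]_n)
    (x : {ffun I -> T} -> 'cV[R]_n) (B : R) (sg : T -> R) :
  (0 < #|T|)%N -> \sum_t sg t = 0 -> (forall t, sg t ^+ 2 = 1) ->
  (forall s, l2norm (x s) <= B) ->
  \sum_(s : {ffun I -> T}) \sum_i sg (s i) * ((w i)^T *m x s) 0 0 <=
  #|{ffun I -> T}|%:R * (B * Num.sqrt (\sum_i l2norm (w i) ^+ 2)).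
Proof.
move=> T_gt0 sg0 sg1 xB.
have [s0 _] : exists s : {ffun I -> T}, True.
  by move/card_gt0P: (T_gt0) => [t _]; exists [ffun=> t].
have B0 : 0 <= B := le_trans (l2norm_ge0 _) (xB s0).
pose W (s : {ffun I -> T}) := \sum_i sg (s i) *: w i.
have -> : \sum_(s : {ffun I -> T}) \sum_i sg (s i) * ((w i)^T *m x s) 0 0 =
          \sum_s ((W s)^T *m x s) 0 0.
  apply: eq_bigr => s _; rewrite /W linear_sum/= mulmx_suml summxE.
  by apply: eq_bigr => i _; rewrite linearZ/= -scalemxAl [RHS]mxE.
apply: (@le_trans _ _ (\sum_s B * l2norm (W s))).
  apply: ler_sum => s _; apply: le_trans (cauchy_schwarz _ _) _.
  by rewrite mulrC ler_wpM2r ?l2norm_ge0.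
rewrite -mulr_sumr mulrCA ler_wpM2l//.
apply: le_trans (_ : \sum_s 1 * l2norm (W s) <= _).
  by apply: ler_sum => s _; rewrite mul1r.
apply: le_trans (cauchy_schwarz_sum _ _) _.
under eq_bigr do rewrite expr1n; rewrite sumr_const.
have -> : \sum_s l2norm (W s) ^+ 2 =
    #|{ffun I -> T}|%:R * \sum_i l2norm (w i) ^+ 2.
  under eq_bigr do rewrite sqr_l2norm.
  rewrite exchange_big/=; under [in RHS]eq_bigr do rewrite sqr_l2norm.
  rewrite [in RHS]exchange_big mulr_sumr/=; apply: eq_bigr => k _.
  have E s : W s k 0 ^+ 2 =
      \sum_i \sum_j (w i k 0 * w j k 0) * (sg (s i) * sg (s j)).
    rewrite /W summxE expr2 mulr_suml; apply: eq_bigr => i _.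
    by rewrite mulr_sumr; apply: eq_bigr => j _; rewrite !mxE; ring.
  under eq_bigr do rewrite E.
  rewrite exchange_big mulr_sumr/=; apply: eq_bigr => i _.
  rewrite exchange_big/= (bigD1 i)//= [X in _ + X]big1 ?addr0; last first.
    move=> j ji; rewrite -mulr_sumr sum_ffun_orthogonal// eq_sym (negbTE ji).
    by rewrite mul0r mulr0.
  by rewrite -mulr_sumr sum_ffun_orthogonal// eqxx mul1r mulrC expr2.
rewrite sqrtrM ?ler0n// mulrA -expr2 sqr_sqrtr ?ler0n//.
Qed.

End resampling.

Section contraction.
Context {R : realType}.

Definition sgn_of (c : bool) : R := (-1) ^+ c.

Lemma sum_prod_type {T U : finType} (F : T * U -> R) :
  \sum_p F p = \sum_t \sum_u F (t, u).
Proof. by rewrite pair_bigA; apply: eq_bigr; case. Qed.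

(** Let [y] and [z] maximize [A + f] and [A - f].  With [G] and [K] the increments
of [g] and [k] between [y] and [z], evaluating the four maxima on the right at [y]
or [z] gives [2 (A y + A z) + 2 |G + K| + 2 |G - K|] or more, while the left-hand
side is at most [2 (A y + A z) + 2 (|G| + |K|)].  A single sign could not produce
both [|G + K|] and [|G - K|]. *)
Lemma sum_finmax_two_signs {Z : finType} (z0 : Z) (A f g k : Z -> R) :
  (forall y z, `|f y - f z| <= `|g y - g z| + `|k y - k z|) ->
  \sum_(t : bool * bool) finmax z0 (fun z => A z + sgn_of t.1 * f z) <=
  \sum_(t : bool * bool)
     finmax z0 (fun z => A z + 2 * (sgn_of t.1 * g z + sgn_of t.2 * k z)).
Proof.
move=> fgk.
rewrite !sum_prod_type !big_bool /sgn_of /= expr1 expr0.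
have [y ->] := finmax_attained z0 (fun z => A z + 1 * f z).
have [z ->] := finmax_attained z0 (fun z => A z + -1 * f z).
have := fgk y z; set Mmm := finmax _ _; set Mmp := finmax _ _;
  set Mpm := finmax _ _; set Mpp := finmax _ _.
have := finmax_ge z0 (fun z => A z + 2 * (-1 * g z + -1 * k z)) y.
have := finmax_ge z0 (fun z => A z + 2 * (-1 * g z + -1 * k z)) z.
have := finmax_ge z0 (fun z => A z + 2 * (-1 * g z + 1 * k z)) y.
have := finmax_ge z0 (fun z => A z + 2 * (-1 * g z + 1 * k z)) z.
have := finmax_ge z0 (fun z => A z + 2 * (1 * g z + -1 * k z)) y.
have := finmax_ge z0 (fun z => A z + 2 * (1 * g z + -1 * k z)) z.
have := finmax_ge z0 (fun z => A z + 2 * (1 * g z + 1 * k z)) y.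
have := finmax_ge z0 (fun z => A z + 2 * (1 * g z + 1 * k z)) z.
rewrite -/Mmm -/Mmp -/Mpm -/Mpp => h1 h2 h3 h4 h5 h6 h7 h8.
clearbody Mmm Mmp Mpm Mpp; move=> /(le_trans (ler_norm _)).
by case: (ger0P (g y - g z)) => hg; case: (ger0P (k y - k z)) => hk hf; lra.
Qed.

Lemma sum_ffun_fst {I T U : finType} (F : {ffun I -> T} -> R) :
  \sum_(p : {ffun I -> T * U}) F [ffun i => (p i).1] =
  #|{ffun I -> U}|%:R * \sum_s F s.
Proof.
pose h (q : {ffun I -> T} * {ffun I -> U}) := [ffun i => (q.1 i, q.2 i)].
pose h' (p : {ffun I -> T * U}) := ([ffun i => (p i).1], [ffun i => (p i).2]).
have hK : cancel h h'.
  by move=> [s s']; congr pair; apply/ffunP => i; rewrite !ffunE.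
have h'K : cancel h' h.
  by move=> p; apply/ffunP => i; rewrite !ffunE /=; case: (p i).
rewrite (reindex h); last by exists h' => ? _.
rewrite sum_prod_type mulr_sumr; apply: eq_bigr => s _.
rewrite mulr_natl -sumr_const; apply: eq_bigr => s' _.
by congr F; apply/ffunP => i; rewrite !ffunE.
Qed.

(** The contraction is applied to [f i z = phi (w_i . x_z + b_i) (u_z . v_i)], with
[u_z] the direction dual to the sum at the sign vector [z].  Taking the sign vectors
themselves as index set of the process is what makes its maxima finite. *)
Lemma sum_signs_neuron (I : finType) (n d : nat) (w : I -> 'cV[R]_n) (b : I -> R)
    (v : I -> 'cV[R]_d) (phi : R -> R) (V B : R)
    (x : {ffun I -> bool} -> 'cV[R]_n) :
  (forall r t, `|phi r - phi t| <= `|r - t|) -> (forall r, `|phi r| <= 1) ->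
  (forall i, l2norm (v i) <= V) -> (forall s, l2norm (x s) <= B) -> 0 <= V ->
  \sum_(s : {ffun I -> bool}) l2norm (\sum_i sgn_of (s i) *:
      (phi (((w i)^T *m x s) 0 0 + b i) *: v i)) <=
  #|{ffun I -> bool}|%:R *
    (2 * (V * B * Num.sqrt (\sum_i l2norm (w i) ^+ 2) +
          Num.sqrt (\sum_i l2norm (v i) ^+ 2))).
Proof.
move=> philip phi1 vV xB V0.
pose Y (s : {ffun I -> bool}) :=
  \sum_i sgn_of (s i) *: (phi (((w i)^T *m x s) 0 0 + b i) *: v i).
have /choice[u hu] (s : {ffun I -> bool}) : exists u : 'cV[R]_d,
    l2norm u <= 1 /\ (u^T *m Y s) 0 0 = l2norm (Y s).
  by have [u] := l2norm_dual (Y s); exists u.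
pose Z := {ffun I -> bool}; pose z0 : Z := [ffun=> false].
pose k i (z : Z) : R := ((v i)^T *m u z) 0 0.
pose f i (z : Z) : R := phi (((w i)^T *m x z) 0 0 + b i) * k i z.
pose g i (z : Z) : R := V * ((w i)^T *m x z) 0 0.
have dotC m (p q : 'cV[R]_m) : (p^T *m q) 0 0 = (q^T *m p) 0 0.
  by rewrite !dotE; apply: eq_bigr => i _; rewrite mulrC.
have kV i z : `|k i z| <= V.
  have le1 : l2norm (v i) * l2norm (u z) <= V.
    rewrite -[V]mulr1; apply: ler_pM; rewrite ?l2norm_ge0//.
    exact: (hu z).1.
  rewrite ler_norml; apply/andP; split; last first.
    exact: le_trans (cauchy_schwarz _ _) _.
  rewrite lerNl; apply: le_trans le1.
  have := cauchy_schwarz (v i) (- u z).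
  by rewrite mulmxN mxE -[- u z]scaleN1r l2normZ normrN normr1 mul1r.
have fgk i y z : `|f i y - f i z| <= `|g i y - g i z| + `|k i y - k i z|.
  rewrite /f /g.
  set py := phi _; set pz := phi _.
  have -> : py * k i y - pz * k i z = (py - pz) * k i y + pz * (k i y - k i z).
    by ring.
  apply: le_trans (ler_normD _ _) _; apply: lerD.
    rewrite -mulrBr !normrM mulrC (ger0_norm V0); apply: ler_pM => //.
    pose r := ((w i)^T *m x y) 0 0 + b i; pose t := ((w i)^T *m x z) 0 0 + b i.
    apply: le_trans (philip r t) _.
    by rewrite /r /t opprD addrACA subrr addr0.
  by rewrite normrM ler_piMl// phi1.
apply: (@le_trans _ _ (\sum_(s : Z) finmax z0
    (fun z => \sum_i sgn_of (s i) * f i z))).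
  apply: ler_sum => s _; apply: le_trans (finmax_ge _ _ s).
  rewrite -/(Y s) -(hu s).2 /Y mulmx_sumr summxE; apply: ler_sum => i _.
  by rewrite -!scalemxAr [X in X <= _]mxE [X in _ * X <= _]mxE /f /k (dotC _ (v i)).
have N0 : 0 < #|{ffun I -> bool}|%:R :> R.
  by rewrite ltr0n; apply/card_gt0P; exists z0.
have T0 : (0 < #|{: bool * bool}|)%N by rewrite card_prod card_bool.
(* Summing over pairs of signs multiplies the left-hand side by N. *)
rewrite -(ler_pM2l N0).
rewrite -(sum_ffun_fst (fun s => finmax z0 (fun z => \sum_i sgn_of (s i) * f i z))).
rewrite (eq_bigr (fun p : {ffun I -> bool * bool} =>
  finmax z0 (fun z => \sum_i sgn_of (p i).1 * f i z))); last first.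
  by move=> p _; apply: eq_finmax => z; apply: eq_bigr => i _; rewrite ffunE.
apply: le_trans (@sum_finmax_tensor R I _ Z z0
  (fun i t z => sgn_of t.1 * f i z)
  (fun i t z => 2 * (sgn_of t.1 * g i z + sgn_of t.2 * k i z)) T0 _) _.
  by move=> i A; exact: sum_finmax_two_signs.
have /choice[m hm] (p : {ffun I -> bool * bool}) : exists z, finmax z0 (fun z =>
    \sum_i 2 * (sgn_of (p i).1 * g i z + sgn_of (p i).2 * k i z)) =
    2 * V * (\sum_i sgn_of (p i).1 * ((w i)^T *m x z) 0 0) +
    2 * (\sum_i sgn_of (p i).2 * ((v i)^T *m u z) 0 0).
  have [z ->] := finmax_attained z0 (fun z =>
    \sum_i 2 * (sgn_of (p i).1 * g i z + sgn_of (p i).2 * k i z)).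
  exists z; rewrite !mulr_sumr -big_split; apply: eq_bigr => i _.
  by rewrite /g /k/=; ring.
under eq_bigr do rewrite hm.
rewrite big_split/= -!mulr_sumr.
have sgn_sq c : sgn_of c ^+ 2 = 1 by rewrite /sgn_of sqrr_sign.
have sum_sgn : \sum_(c : bool) sgn_of c = 0.
  by rewrite big_bool /sgn_of /= expr1 expr0 addNr.
have sum1 : \sum_(t : bool * bool) sgn_of t.1 = 0.
  rewrite sum_prod_type exchange_big/=.
  by rewrite big1// => c _; rewrite sum_sgn.
have sum2 : \sum_(t : bool * bool) sgn_of t.2 = 0.
  rewrite sum_prod_type /=.
  by rewrite big1.
have Nsq : #|{ffun I -> bool * bool}|%:R = #|{ffun I -> bool}|%:R ^+ 2 :> R.
  by rewrite !card_ffun card_prod card_bool expnMn natrM expr2.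
have := @sum_rademacher_linear R I _ n w (fun p => x (m p)) B (sgn_of \o fst) T0 sum1
  (fun _ => sgn_sq _) (fun _ => xB _).
have := @sum_rademacher_linear R I _ d v (fun p => u (m p)) 1 (sgn_of \o snd) T0 sum2
  (fun _ => sgn_sq _) (fun p => (hu _).1).
rewrite mul1r Nsq /= => H1 H2.
apply: le_trans (lerD (ler_wpM2l _ H2) (ler_wpM2l _ H1)) _ => //.
  by rewrite mulr_ge0.
by rewrite le_eqVlt; apply/orP; left; apply/eqP; ring.
Qed.

End contraction.

(** * Integrals: independence and Jensen's inequality *)

Section independent_integral.
Context {d : measure_display} {T : measurableType d} {R : realType}.
Variable P : probability T R.
Local Open Scope ereal_scope.

Lemma integral_mrestr (E : set T) (mE : measurable E) (f : T -> \bar R) :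
  measurable_fun [set: T] f -> (forall x, 0 <= f x) ->
  \int[mrestr P mE]_x f x = \int[P]_(x in E) f x.
Proof.
move=> mf f0.
have mEC : measurable (~` E) by exact: measurableC.
rewrite (@ge0_negligible_integral _ _ _ (mrestr P mE) setT (~` E) f)//; last first.
  by rewrite /= /mrestr setICl measure0.
rewrite setTD setCK; apply: eq_measure_integral => A mA AE.
by rewrite /mrestr; congr (P _); apply/setIidPl.
Qed.

(** For [f] measurable with respect to the sigma-algebra generated by [G], both sides
are integrals of [f] against measures on that sigma-algebra, namely the traces of
[A |-> P (A `&` E)] and of [P E * P]; independence says that these coincide. *)
Lemma integral_indep (G : set (set T)) (E : set T) (f : T -> \bar R) :
  <<s G >> `<=` measurable -> measurable E ->
  (forall A, <<s G >> A -> P (A `&` E) = P A * P E) ->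
  measurable_fun [set: g_sigma_algebraType G] (f : g_sigma_algebraType G -> _) ->
  (forall x, 0 <= f x) ->
  \int[P]_(x in E) f x = P E * \int[P]_x f x.
Proof.
move=> GT mE indep mf f0.
pose id' : T -> g_sigma_algebraType G := id.
have mid : measurable_fun [set: T] id'.
  by move=> _ A mA; rewrite setTI; exact: GT.
have mfT : measurable_fun [set: T] f by exact: (measurableT_comp mf mid).
have PE : P E \is a fin_num by exact: fin_num_measure.
have PE0 : (0 <= fine (P E))%R by apply: fine_ge0.
pose trace m : {measure set g_sigma_algebraType G -> \bar R} :=
  measure_function_pushforward__canonical__measure_function_Measure m mid.
have traceE (m : {measure set T -> \bar R}) :
    \int[trace m]_x f x = \int[m]_x f x.
  by rewrite ge0_integral_pushforward// => x _.
rewrite -(integral_mrestr mE)// -[in RHS]traceE -traceE.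
rewrite -[P E](fineK PE).
transitivity (\int[mscale (NngNum PE0) (trace P)]_x f x).
  apply: eq_measure_integral => A mA _.
  transitivity (P A * P E); first exact: indep.
  by rewrite muleC -[in LHS](fineK PE).
by rewrite ge0_integral_mscale.
Qed.

End independent_integral.

Section sqrt_integral.
Context {d : measure_display} {T : measurableType d} {R : realType}.
Variable P : probability T R.
Local Open Scope ereal_scope.

Lemma measurable_sqrt (f : T -> R) :
  measurable_fun [set: T] f -> measurable_fun [set: T] (fun x => Num.sqrt (f x)).
Proof.
move=> mf; have ms := continuous_measurable_fun (@sqrt_continuous R).
exact: (measurableT_comp ms mf).
Qed.

(** Integrate [sqrt a <= a / (2 c) + c / 2] and choose [c] to be the square root of
the integral, or let [c] tend to 0 if the integral vanishes. *)
Lemma integral_sqrt_le (f : T -> R) :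
  measurable_fun [set: T] f -> (forall x, (0 <= f x)%R) ->
  \int[P]_x (Num.sqrt (f x))%:E <= sqrte (\int[P]_x (f x)%:E).
Proof.
move=> mf f0.
have I0 : 0 <= \int[P]_x (f x)%:E by apply: integral_ge0 => x _; rewrite lee_fin.
have msf := measurable_sqrt mf.
have amgm c : (0 < c)%R -> \int[P]_x (Num.sqrt (f x))%:E <=
    ((2 * c)^-1)%:E * \int[P]_x (f x)%:E + (c / 2)%:E.
  move=> c0.
  have c1 : (0 <= (2 * c)^-1)%R by rewrite invr_ge0 mulr_ge0// ltW.
  have c2 : (0 <= c / 2)%R by rewrite divr_ge0// ltW.
  apply: (@le_trans _ _ (\int[P]_x (((2 * c)^-1)%:E * (f x)%:E + (c / 2)%:E))).
    apply: ge0_le_integral => //.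
    - exact/measurable_EFinP.
    - apply: emeasurable_funD => //; apply: measurable_funeM.
      exact/measurable_EFinP.
    move=> x _; rewrite -EFinM -EFinD lee_fin.
    have := sqr_ge0 (Num.sqrt (f x) - c)%R.
    rewrite sqrrB sqr_sqrtr// => h.
    rewrite -subr_ge0.
    have -> : ((2 * c)^-1 * f x + c / 2 - Num.sqrt (f x) =
      (2 * c)^-1 * (f x - Num.sqrt (f x) * c *+ 2 + c ^+ 2))%R.
      by field; rewrite gt_eqF.
    exact: mulr_ge0.
  have mcf : measurable_fun [set: T] (fun x => ((2 * c)^-1)%:E * (f x)%:E).
    by apply: measurable_funeM; exact/measurable_EFinP.
  rewrite ge0_integralD//; last by move=> x _; rewrite -EFinM lee_fin mulr_ge0.
  rewrite integral_cst//= probability_setT mule1.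
  rewrite ge0_integralZl//; first exact/measurable_EFinP.
  by move=> x _; rewrite lee_fin.
have [->|Ify] := eqVneq (\int[P]_x (f x)%:E) +oo; first by rewrite leey.
have Ifin : \int[P]_x (f x)%:E \is a fin_num by rewrite ge0_fin_numE// ltey.
move: amgm I0; rewrite -(fineK Ifin); set I := fine _ => amgm.
rewrite lee_fin => I0 /=.
have [I_gt0|] := ltP 0%R I.
  have sI0 : (0 < Num.sqrt I)%R by rewrite sqrtr_gt0.
  apply: le_trans (amgm _ sI0) _; rewrite -EFinM -EFinD lee_fin.
  rewrite -[X in (_ * X)%R](sqr_sqrtr I0) le_eqVlt; apply/orP; left; apply/eqP.
  by field; rewrite gt_eqF.
move=> I_le0; have -> : I = 0%R by apply/eqP; rewrite eq_le I_le0 I0.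
rewrite sqrtr0; apply/lee_addgt0Pr => e e0; rewrite add0e.
have I00 : I = 0%R by apply/eqP; rewrite eq_le I_le0 I0.
have := amgm (e * 2)%R; rewrite I00 mule0 add0e mulfK//; apply.
by rewrite mulr_gt0.
Qed.

End sqrt_integral.

(** * Measurability of suprema *)

Section countable_sup.
Context {R : realType}.

(** Subsets of a separable metric space are separable: a point of [X] is chosen
near each rational vector [q], at each scale [1 / (k + 1)] where there is one. *)
Lemma dense_sequence n (X : set 'cV[R]_n) : X !=set0 ->
  exists D : nat -> 'cV[R]_n, (forall k, X (D k)) /\
    forall x (U : set 'cV[R]_n), X x -> nbhs x U -> exists k, U (D k).
Proof.
move=> [x0 Xx0].
pose near_pt (q : 'cV[rat]_n) (k : nat) : set 'cV[R]_n :=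
  X `&` [set x | forall i, `|x i 0 - ratr (q i 0)| < k.+1%:R^-1].
have /choice[h hP] (p : 'cV[rat]_n * nat) :
    exists x, X x /\ (near_pt p.1 p.2 !=set0 -> near_pt p.1 p.2 x).
  have [[x nx]|no] := pselect (near_pt p.1 p.2 !=set0); first by exists x; case: nx.
  by exists x0.
exists (fun m => if unpickle m is Some p then h p else x0).
split=> [m|x U Xx /nbhs_ballP[e /= e0 eU]].
  by case: unpickle => // p; case: (hP p).
have e20 : 0 < e / 2 by rewrite divr_gt0.
have [k /ltW ke] : exists k : nat, k.+1%:R^-1 < e / 2.
  have [k _ /(_ k (leqnn k))] := near_infty_natSinv_lt (PosNum e20).
  by exists k.
have /choice[q hq] (i : 'I_n) : exists q : rat, `|x i 0 - ratr q| < k.+1%:R^-1.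
  have : x i 0 - k.+1%:R^-1 < x i 0 + k.+1%:R^-1.
    by rewrite ltrBlDr -addrA ltrDl addr_gt0.
  move=> /rat_in_itvoo[q]; rewrite in_itv/= => /andP[q1 q2]; exists q.
  rewrite ltr_norml; move: (k.+1%:R^-1) q1 q2 => r q1 q2.
  by apply/andP; split; lra.
pose qv : 'cV[rat]_n := \col_i q i.
have [_ []] := hP (qv, k).
  by exists x; split => //= i; rewrite mxE.
move=> _ hx; exists (pickle (qv, k)); rewrite pickleK; apply: eU; split => // i j.
rewrite ord1 /ball/=; have := hx i; rewrite mxE => h1; have := hq i => h2.
have -> : x i 0 - h (qv, k) i 0 =
    (x i 0 - ratr (q i)) - (h (qv, k) i 0 - ratr (q i)) by ring.
apply: le_lt_trans (ler_normB _ _) _; rewrite [ltRHS]splitr.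
by apply: ltrD; apply: lt_le_trans ke.
Qed.

(** By continuity the supremum may be taken over a countable dense subset of [X]. *)
Lemma measurable_sup_continuous d (T : measurableType d) n (X : set 'cV[R]_n)
    (F : 'cV[R]_n -> T -> R) : X !=set0 ->
  (forall x, measurable_fun [set: T] (F x)) ->
  (forall t, continuous (F ^~ t)) ->
  measurable_fun [set: T] (fun t => ereal_sup [set (F x t)%:E | x in X]).
Proof.
move=> /dense_sequence[D [XD dD]] mF cF.
have -> : (fun t => ereal_sup [set (F x t)%:E | x in X]) =
          (fun t => esups (fun k => (F (D k) t)%:E) 0%N).
  apply/funext => t; rewrite /esups/= /sdrop; apply/eqP; rewrite eq_le.
  apply/andP; split; last first.
    apply: ereal_sup_le => _ [k _ <-]; exists (D k) => //; exact: XD.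
  apply: ge_ereal_sup => _ [x Xx <-].
  rewrite leNgt; apply/negP => lt_sup.
  set s := ereal_sup _ in lt_sup.
  have sD k : ((F (D k) t)%:E <= s)%E.
    by apply: ereal_sup_ubound; exists k.
  have sfin : s \is a fin_num.
    rewrite fin_numElt (lt_le_trans _ (sD 0%N)) ?ltNyr//=.
    exact: lt_trans lt_sup (ltry _).
  move: lt_sup sD; rewrite -(fineK sfin) lte_fin => lt_sup sD.
  have [k] := dD _ _ Xx (cvgr_gt _ (cF t x) _ lt_sup).
  by have := sD k; rewrite lee_fin leNgt => /negP.
by apply: measurable_fun_esups => k; exact/measurable_EFinP.
Qed.

End countable_sup.

(** * The operator norm *)

Section opnorm.
Context {R : realType}.
Variables m n : nat.
Implicit Type A : 'M[R]_(m, n).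

Lemma opnorm_has_sup A :
  has_sup [set l2norm (A *m u) | u in [set u : 'cV[R]_n | l2norm u <= 1]].
Proof.
split; first by exists (l2norm (A *m 0)), 0 => //=; rewrite l2norm0.
(* A crude bound: the coordinates of a dual unit vector are at most 1. *)
exists (\sum_i l2norm (row i A)^T) => _ [u /= u1 <-].
have S0 : 0 <= \sum_i l2norm (row i A)^T.
  by apply: sumr_ge0 => i _; exact: l2norm_ge0.
have [z z1 <-] := l2norm_dual (A *m u).
rewrite dotE; apply: ler_sum => i _.
have zi1 : `|z i 0| <= 1.
  rewrite -(expr_le1 (n := 2))// -normrX ger0_norm ?sqr_ge0//.
  apply: le_trans (_ : l2norm z ^+ 2 <= _); last first.
    by rewrite expr_le1// l2norm_ge0.
  rewrite sqr_l2norm (bigD1 i)//= lerDl sumr_ge0// => k _.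
  exact: sqr_ge0.
apply: le_trans (ler_norm _) _; rewrite normrM.
have rowE v : (A *m v) i 0 = (((row i A)^T)^T *m v) 0 0.
  by rewrite trmxK -row_mul [RHS]mxE.
have Ai : `|(A *m u) i 0| <= l2norm (row i A)^T.
  rewrite -[X in _ <= X]mulr1 ler_norml; apply/andP; split.
    rewrite lerNl.
    have -> : - (A *m u) i 0 = (((row i A)^T)^T *m (- u)) 0 0.
      by rewrite -rowE mulmxN [RHS]mxE.
    apply: le_trans (cauchy_schwarz _ _) _.
    apply: ler_wpM2l; first exact: l2norm_ge0.
    by rewrite -[- u]scaleN1r l2normZ normrN normr1 mul1r.
  rewrite rowE; apply: le_trans (cauchy_schwarz _ _) _.
  by apply: ler_wpM2l; first exact: l2norm_ge0.
by apply: le_trans Ai; rewrite ler_piMl.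
Qed.

Lemma opnorm_ge0 A : 0 <= opnorm A.
Proof.
apply: (@le_trans _ _ (l2norm (A *m 0))); first exact: l2norm_ge0.
apply: ub_le_sup; first exact: (opnorm_has_sup A).2.
by exists 0 => //=; rewrite l2norm0.
Qed.

Lemma l2norm_mulmx_le A u : l2norm (A *m u) <= opnorm A * l2norm u.
Proof.
have [u0|u0] := eqVneq (l2norm u) 0.
  by rewrite (l2norm_eq0 u0) mulmx0 !l2norm0 mulr0.
have uinv : 0 <= (l2norm u)^-1 by rewrite invr_ge0 l2norm_ge0.
rewrite -ler_pdivrMr ?lt0r ?u0 ?l2norm_ge0// mulrC.
apply: ub_le_sup; first exact: (opnorm_has_sup A).2.
exists ((l2norm u)^-1 *: u); first by rewrite /= l2normZ ger0_norm ?mulVf.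
by rewrite -scalemxAr l2normZ ger0_norm.
Qed.

(** An extended-real supremum of continuous functions, to which
[measurable_sup_continuous] applies. *)
Lemma opnorm_le A c :
  (opnorm A <= c) =
  (ereal_sup [set (l2norm (A *m u))%:E | u in [set u : 'cV[R]_n | (l2norm u <= 1)%R]]
     <= c%:E)%E.
Proof.
apply/idP/idP => h.
  apply: ge_ereal_sup => _ [u u1 <-]; rewrite lee_fin; apply: le_trans h.
  by apply: ub_le_sup; [exact: (opnorm_has_sup A).2|exists u].
apply: ge_sup; first exact: (opnorm_has_sup A).1.
move=> _ [u u1 <-]; rewrite -lee_fin; apply: le_trans h.
by apply: ereal_sup_ubound; exists u.
Qed.

End opnorm.

(** * Continuity and measurability of norms *)

Section regularity.
Context {R : realType}.

Lemma continuous_l2norm (S : topologicalType) m (f : S -> 'cV[R]_m) :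
  (forall i, continuous (fun y => f y i 0)) -> continuous (fun y => l2norm (f y)).
Proof.
move=> cf y; apply: (@continuous_comp _ _ _ (fun y => \sum_i f y i 0 ^+ 2) Num.sqrt);
  last exact: sqrt_continuous.
apply: cvg_big => [|i _]; first by move=> p; exact: add_continuous.
by apply: (@continuous_comp _ _ _ (fun y => f y i 0) (fun r => r ^+ 2));
  [exact: cf|exact: exprn_continuous].
Qed.

Lemma continuous_linear_entry p m (A : 'M[R]_(p, m)) i :
  continuous (fun y : 'cV[R]_m => (A *m y) i 0).
Proof.
under eq_fun do rewrite mxE.
apply: continuous_big => [q|j _ y]; first exact: add_continuous.
by apply: continuousM; [exact: cst_continuous|exact: coord_continuous].
Qed.

Context {d : measure_display} {T : measurableType d}.

Lemma measurable_l2norm m (f : T -> 'cV[R]_m) :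
  mx_measurable f -> measurable_fun [set: T] (fun t => l2norm (f t)).
Proof.
move=> mf; apply: measurable_sqrt; apply: measurable_sum => i.
exact/measurable_funX/mf.
Qed.

Lemma mx_measurable_mul p q r (f : T -> 'M[R]_(p, q)) (g : T -> 'M[R]_(q, r)) :
  mx_measurable f -> mx_measurable g -> mx_measurable (fun t => f t *m g t).
Proof.
move=> mf mg i j; under eq_fun do rewrite mxE.
by apply: measurable_sum => k; apply: measurable_funM; [exact: mf|exact: mg].
Qed.

Lemma measurable_opnorm_le p q (f : T -> 'M[R]_(p, q)) c :
  mx_measurable f -> measurable_fun [set: T] (fun t => opnorm (f t) <= c).
Proof.
move=> mf; under eq_fun do rewrite opnorm_le.
pose g t := ereal_sup [set (l2norm (f t *m u))%:E
  | u in [set u : 'cV[R]_q | l2norm u <= 1]].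
have mg : measurable_fun [set: T] g.
  apply: (@measurable_sup_continuous R d T q _ (fun u t => l2norm (f t *m u))).
  - by exists 0; rewrite /= l2norm0.
  - move=> u; apply: measurable_l2norm; exact: mx_measurable_mul.
  - by move=> t; apply: continuous_l2norm => i; exact: continuous_linear_entry.
apply: (measurable_fun_bool true).
rewrite (_ : _ @^-1` _ = [set t | (g t <= c%:E)%E])//.
by have := emeasurable_fun_infty_c measurableT mg c%:E.
Qed.

End regularity.

(** * Finite sums of suprema *)

Section sums_of_sups.
Context {R : realType}.

(** Each supremum is finite, hence approached within [e / (#|S| + 1)] by a choice
[x s]; the slack [e] is arbitrary. *)
Lemma sum_ereal_sup_le (S : finType) (T : Type) (X : set T) (N : S -> T -> R)
    (C : R) :
  X !=set0 -> (forall s x, 0 <= N s x) ->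
  (forall x : S -> T, (forall s, X (x s)) -> \sum_s N s (x s) <= C) ->
  (\sum_s ereal_sup [set (N s x)%:E | x in X] <= C%:E)%E.
Proof.
move=> [x0 Xx0] N0 NC.
have bnd s x : X x -> N s x <= C.
  move=> Xx; apply: le_trans (NC (fun=> x) (fun=> Xx)).
  by rewrite (bigD1 s)//= lerDl sumr_ge0.
have fin s : ereal_sup [set (N s x)%:E | x in X] \is a fin_num.
  rewrite fin_numElt; apply/andP; split.
    apply: (@lt_le_trans _ _ (N s x0)%:E); first exact: ltNyr.
    by apply: ereal_sup_ubound; exists x0.
  apply: (@le_lt_trans _ _ C%:E); last exact: ltry.
  by apply: ge_ereal_sup => _ [x Xx <-]; rewrite lee_fin bnd.
apply/lee_addgt0Pr => e e0.
pose e' := e / (#|S|.+1%:R).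
have e'0 : 0 < e' by rewrite divr_gt0.
have /choice[x hx] s : exists x, X x /\
    (ereal_sup [set (N s x)%:E | x in X] <= (N s x + e')%:E)%E.
  have [_ [x Xx <-] /ltW] := ub_ereal_sup_adherent e'0 (fin s).
  by rewrite leeBlDr// -EFinD; exists x.
apply: (@le_trans _ _ (\sum_s (N s (x s) + e')%:E)%E).
  by apply: lee_sum => s _; exact: (hx s).2.
rewrite sumEFin big_split/= sumr_const -EFinD lee_fin lerD//.
  by apply: NC => s; exact: (hx s).1.
rewrite -[X in X <= _]mulr_natr /e' mulrAC ler_pdivrMr// ler_wpM2l ?ltW//.
by rewrite ltr_nat.
Qed.

End sums_of_sups.

(** * Averaging over the signs *)

Section signs.
Context {dO : measure_display} {Omega : measurableType dO} {R : realType}.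
Variable P : probability Omega R.
Context {dT : measure_display} {T : measurableType dT} {I : finType}.
Local Open Scope ereal_scope.

(** The generators of [sigma_family Y], named so that they can carry the structure
of a measurable space: being measurable on it means depending on [Y] only. *)
Definition sigma_gen (Y : I -> {RV P >-> T}) : set (set Omega) :=
  [set S | exists i A, measurable A /\ S = Y i @^-1` A].

Lemma sigma_gen_measurable (Y : I -> {RV P >-> T}) :
  <<s sigma_gen Y >> `<=` measurable.
Proof.
apply: smallest_sub; first exact: sigma_algebra_measurable.
move=> _ [i [A [mA ->]]]; rewrite -[X in measurable X]setTI.
exact: measurable_funPT.
Qed.

Lemma measurable_sigma_gen (Y : I -> {RV P >-> T}) i :
  measurable_fun [set: g_sigma_algebraType (sigma_gen Y)]
    (Y i : g_sigma_algebraType (sigma_gen Y) -> T).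
Proof.
by move=> _ A mA; rewrite setTI; apply: sub_sigma_algebra; exists i, A.
Qed.

End signs.

Section symmetrization.
Context {dO : measure_display} {Omega : measurableType dO} {R : realType}.
Variable P : probability Omega R.
Context {dT : measure_display} {T : measurableType dT} {I : finType}.
Variables (Y : I -> {RV P >-> T}) (eps : I -> {RV P >-> R}).
Hypothesis eps_indep : mutually_independent eps.
Hypothesis eps_rad : forall i, rademacher (eps i).
Hypothesis Y_eps : independent_families Y eps.
Local Open Scope ereal_scope.

Definition sign_event (s : {ffun I -> bool}) : set Omega :=
  \bigcap_(i in [set` [set: I]%SET]) eps i @^-1` [set sgn_of (s i)].

Lemma sign_eventP s o : sign_event s o <-> forall i, eps i o = sgn_of (s i).
Proof.
split=> [h i|h i _]; last exact: h.
by apply: (h i); rewrite /= inE.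
Qed.

Lemma sigma_sign_event s : sigma_family eps (sign_event s).
Proof.
apply: (@fin_bigcap_measurable _ (g_sigma_algebraType (sigma_gen eps))) => //.
move=> i _; apply: sub_sigma_algebra; exists i, [set sgn_of (s i)].
by split => //; exact: measurable_set1.
Qed.

Lemma measurable_sign_event s : measurable (sign_event s).
Proof. exact: (sigma_gen_measurable (sigma_sign_event s)). Qed.

Lemma sign_event_prob s : P (sign_event s) = (#|{ffun I -> bool}|%:R^-1)%:E.
Proof.
rewrite /sign_event eps_indep; last by move=> i; exact: measurable_set1.
rewrite (eq_bigr (fun=> (2^-1)%:E)); last first.
  move=> i _; rewrite /sgn_of; case: (s i) => /=; rewrite ?expr1 ?expr0.
    exact: (eps_rad i).2.
  exact: (eps_rad i).1.
by rewrite prodEFin prodr_const cardsT card_ffun card_bool natrX exprVn.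
Qed.

Lemma trivIset_sign_event : trivIset [set: {ffun I -> bool}] sign_event.
Proof.
move=> s s' _ _ [y [/sign_eventP hs /sign_eventP hs']].
apply/ffunP => i; have := hs i; rewrite hs' /sgn_of.
by case: (s i); case: (s' i) => //=; rewrite ?expr1 ?expr0; lra.
Qed.

(** The events [sign_event s] partition the sample space up to a null set.  On each
of them [F] coincides with [H s], which only depends on [Y], and the event is
independent of [Y]. *)
Lemma integral_signs (F : Omega -> \bar R)
    (H : {ffun I -> bool} -> Omega -> \bar R) :
  measurable_fun [set: Omega] F -> (forall o, 0 <= F o) ->
  (forall s, measurable_fun [set: g_sigma_algebraType (sigma_gen Y)]
     (H s : g_sigma_algebraType (sigma_gen Y) -> \bar R)) ->
  (forall s o, 0 <= H s o) ->
  (forall (s : {ffun I -> bool}) o,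
     (forall i, eps i o = sgn_of (s i)) -> F o = H s o) ->
  \int[P]_o F o = (#|{ffun I -> bool}|%:R^-1)%:E * \int[P]_o (\sum_s H s o)%E.
Proof.
move=> mF F0 mH H0 FH.
have mHO s : measurable_fun [set: Omega] (H s).
  move=> _ A mA; have := mH s measurableT A mA; rewrite !setTI.
  exact: sigma_gen_measurable.
pose D := \big[setU/set0]_(s <- index_enum {ffun I -> bool}) sign_event s.
have mD : measurable D.
  by apply: bigsetU_measurable => s _; exact: measurable_sign_event.
have tD : trivIset [set` index_enum {ffun I -> bool}] sign_event.
  exact: sub_trivIset trivIset_sign_event.
have PD : P D = 1.
  have := @ge0_integral_bigsetU _ _ _ P _ sign_event (cst 1)
    (index_enum {ffun I -> bool}) measurable_sign_event (index_enum_uniq _) tD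
    (measurable_cst _) (fun _ _ => lee01).
  rewrite integral_cst// mul1e -/D => ->.
  rewrite (eq_bigr (fun=> (#|{ffun I -> bool}|%:R^-1)%:E)); last first.
    move=> s _; rewrite integral_cst; last exact: measurable_sign_event.
    by rewrite mul1e; exact: sign_event_prob.
  rewrite sumEFin sumr_const -[X in X%:E]mulr_natl mulfV// pnatr_eq0 -lt0n.
  by apply/card_gt0P; exists [ffun=> true].
have PDC : P (~` D) = 0 by rewrite probability_setC// PD subee.
rewrite (@ge0_negligible_integral _ _ _ P setT (~` D) F)//; last exact: measurableC.
rewrite setTD setCK ge0_integral_bigsetU//; last 3 first.
- exact: measurable_sign_event.
- exact: index_enum_uniq.
- exact: measurable_funS mF.
rewrite ge0_integral_sum// ge0_sume_distrr; last first.
  by move=> s _; apply: integral_ge0 => o _.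
apply: eq_bigr => s _; rewrite -(sign_event_prob s).
rewrite -(integral_indep (G := sigma_gen Y))//.
- apply: eq_integral => o; rewrite inE => /sign_eventP.
  exact: FH.
- exact: sigma_gen_measurable.
- exact: measurable_sign_event.
- by move=> A sA; apply: Y_eps => //; exact: sigma_sign_event.
Qed.

End symmetrization.

(** * The truncated neurons *)

Section neurons.
Context {R : realType}.
Variables (n d d1 : nat).
Context {dT : measure_display} {Theta : measurableType dT}.
Variables (w : Theta -> 'cV[R]_n) (b : Theta -> R).
Variables (phi : R -> R) (M : 'cV[R]_n -> 'M[R]_(d, d1)) (BPhi : R -> R).
Variables (alpha : Theta -> 'cV[R]_d1) (eta : R).
Hypothesis hw : mx_measurable w.
Hypothesis hb : measurable_fun [set: Theta] b.
Hypothesis hM : mx_measurable (M \o w).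
Hypothesis halpha : mx_measurable alpha.
Hypothesis phi_lip : forall r t, `|phi r - phi t| <= `|r - t|.

Definition signed_sum (I : finType) (e : I -> R) (t : I -> Theta) x : 'cV[R]_d :=
  \sum_i e i *: (trunc_feature M BPhi w b phi eta x (t i) *m alpha (t i)).

Lemma continuous_phi : continuous phi.
Proof.
move=> r; apply/cvgrPdist_lt => e e0; near=> t.
apply: le_lt_trans (phi_lip _ _) _; near: t.
exact: (@cvgr_dist_lt _ _ _ _ _ id r).
Unshelve. all: by end_near. Qed.

Definition neuron_dir t : 'cV[R]_d := trunc_mx M BPhi eta (w t) *m alpha t.

Lemma signed_sumE (I : finType) (e : I -> R) (t : I -> Theta) x :
  signed_sum e t x = \sum_i e i *:
    (phi (((w (t i))^T *m x) 0 0 + b (t i)) *: neuron_dir (t i)).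
Proof. by apply: eq_bigr => i _; rewrite /trunc_feature -scalemxAl. Qed.

Lemma mx_measurable_dir : mx_measurable neuron_dir.
Proof.
apply: mx_measurable_mul => // i j; rewrite /trunc_mx.
have -> : (fun t => (if opnorm (M (w t)) <= BPhi eta then M (w t) else 0) i j) =
    (fun t => if opnorm (M (w t)) <= BPhi eta then M (w t) i j else 0).
  by apply/funext => t; case: ifP => //; rewrite mxE.
apply: measurable_fun_ifT; last 2 first.
- exact: hM.
- exact: measurable_cst.
exact: (measurable_opnorm_le _ hM).
Qed.

Lemma measurable_act (x : 'cV[R]_n) :
  measurable_fun [set: Theta] (fun t => phi (((w t)^T *m x) 0 0 + b t)).
Proof.
have mphi := continuous_measurable_fun continuous_phi.
apply: (measurableT_comp mphi); apply: measurable_funD => //.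
apply: mx_measurable_mul; last by move=> i j; exact: measurable_cst.
by move=> i j; under eq_fun do rewrite mxE; exact: hw.
Qed.

Lemma continuous_act t :
  continuous (fun x : 'cV[R]_n => phi (((w t)^T *m x) 0 0 + b t)).
Proof.
move=> x.
apply: (@continuous_comp _ _ _ (fun x => ((w t)^T *m x) 0 0 + b t) phi);
  last exact: continuous_phi.
apply: (@continuousD _ _ _ (fun x => ((w t)^T *m x) 0 0) (fun=> b t)).
  exact: continuous_linear_entry.
exact: cst_continuous.
Qed.

(** The measurable space [S] is arbitrary because the lemma is needed both for the
sample space and for its sub-sigma-algebra generated by the parameters. *)
Lemma measurable_supnorm_signed_sum d' (S : measurableType d') (I : finType)
    (X : set 'cV[R]_n) (e : I -> S -> R) (t : I -> S -> Theta) :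
  X !=set0 ->
  (forall i, measurable_fun [set: S] (e i)) ->
  (forall i, measurable_fun [set: S] (t i)) ->
  measurable_fun [set: S]
    (fun o => supnorm X (signed_sum (e^~ o) (t^~ o))).
Proof.
move=> X0 me mt.
apply: (@measurable_sup_continuous R d' S n X
  (fun x o => l2norm (signed_sum (e^~ o) (t^~ o) x))) => //.
- move=> x; apply: measurable_l2norm => j k.
  under eq_fun do rewrite signed_sumE summxE.
  apply: measurable_sum => i.
  under eq_fun do rewrite mxE mxE.
  apply: measurable_funM => //; apply: measurable_funM.
    exact: (measurableT_comp (measurable_act x) (mt i)).
  exact: (measurableT_comp (mx_measurable_dir j k) (mt i)).
move=> o; apply: continuous_l2norm => j.
under eq_fun do rewrite signed_sumE summxE.
apply: continuous_big => [p|i _]; first exact: add_continuous.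
under eq_fun do rewrite mxE mxE.
pose c := neuron_dir (t i o) j 0; have cact := @continuous_act (t i o).
move=> y; apply: (@continuousM R 'cV[R]_n (fun=> e i o)
  (fun x => phi (((w (t i o))^T *m x) 0 0 + b (t i o)) * c)).
  exact: cst_continuous.
apply: (@continuousM R 'cV[R]_n
  (fun x => phi (((w (t i o))^T *m x) 0 0 + b (t i o))) (fun=> c)).
  exact: cact.
exact: cst_continuous.
Qed.

Lemma l2norm_dir_le t (B : R) : 0 <= B -> 0 <= BPhi eta -> l2norm (alpha t) <= B ->
  l2norm (neuron_dir t) <= B * BPhi eta.
Proof.
move=> B0 BP0 aB; rewrite /neuron_dir /trunc_mx; case: ifP => [MB|_]; last first.
  by rewrite mul0mx l2norm0 mulr_ge0.
apply: le_trans (l2norm_mulmx_le _ _) _; rewrite mulrC.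
by apply: ler_pM => //; [exact: l2norm_ge0|exact: opnorm_ge0].
Qed.

(** The factor [Num.sqrt d1%:R] is at least 1, unless [d1 = 0] and all terms of the
sum are 0. *)
Lemma sum_signs_supnorm_le (I : finType) (X : set 'cV[R]_n) (t : I -> Theta)
    (r B : R) :
  X !=set0 -> (forall x, X x -> l2norm x <= r) ->
  (forall a, `|phi a| <= 1) -> 0 <= B -> 0 <= BPhi eta ->
  (forall i, l2norm (alpha (t i)) <= B) ->
  (\sum_(s : {ffun I -> bool}) supnorm X (signed_sum (fun i => sgn_of (s i)) t) <=
   (#|{ffun I -> bool}|%:R *
     (2 * (B * BPhi eta * r * Num.sqrt (\sum_i l2norm (w (t i)) ^+ 2) +
           B * BPhi eta * (Num.sqrt d1%:R * Num.sqrt #|I|%:R))))%:E)%E.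
Proof.
move=> X0 Xr phi1 B0 BP0 aB.
set V := B * BPhi eta.
have V0 : 0 <= V by rewrite mulr_ge0.
apply: sum_ereal_sup_le => //[s x|x Xx]; first exact: l2norm_ge0.
pose v i := neuron_dir (t i).
have vV i : l2norm (v i) <= V by exact: l2norm_dir_le.
under eq_bigr do rewrite signed_sumE.
apply: le_trans (@sum_signs_neuron R _ _ _ (w \o t) (b \o t) v phi V r x
  phi_lip phi1 vV (fun s => Xr _ (Xx s)) V0) _.
rewrite ler_wpM2l ?ler0n// ler_wpM2l// lerD2l.
rewrite -[V in X in _ <= X](ger0_norm V0) -sqrtr_sqr -!sqrtrM ?sqr_ge0 ?ler0n//.
apply: ler_wsqrtr; rewrite -natrM mulnC.
have [d10|d1_gt0] := posnP d1.
  rewrite [in leRHS]d10 muln0 mulr0 big1// => i _.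
  rewrite /v /neuron_dir (_ : alpha _ = 0) ?mulmx0 ?l2norm0 ?expr0n//.
  by apply/matrixP => -[k k_lt]; exfalso; rewrite d10 in k_lt.
apply: (@le_trans _ _ (V ^+ 2 * #|I|%:R)); last first.
  by rewrite ler_wpM2l ?sqr_ge0// ler_nat leq_pmulr.
rewrite mulr_natr -sumr_const; apply: ler_sum => i _.
by rewrite ler_sqr ?nnegrE ?l2norm_ge0.
Qed.

End neurons.

(** * The radius of a compact set *)

Section compact_radius.
Context {R : realType}.

Lemma set_radius_compact n (X : set 'cV[R]_n) : compact X -> X !=set0 ->
  exists r : R, [/\ 0 <= r, set_radius X = r%:E & forall x, X x -> l2norm x <= r].
Proof.
move=> cX [x0 Xx0].
have cl : continuous (@l2norm R n).
  by apply: (@continuous_l2norm R _ n id) => i y; exact: coord_continuous.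
have /compact_bounded[A [_ hA]] : compact (@l2norm R n @` X).
  apply: continuous_compact => //; exact: continuous_subspaceT.
have bnd x : X x -> l2norm x <= A + 1.
  move=> Xx; apply: le_trans (ler_norm _) _; apply: (hA (A + 1)).
    by rewrite ltrDl.
  by exists x.
have ub x : X x -> ((l2norm x)%:E <= set_radius X)%E.
  by move=> Xx; apply: ereal_sup_ubound; exists x.
have rfin : set_radius X \is a fin_num.
  rewrite fin_numElt; apply/andP; split.
    exact: lt_le_trans (ltNyr _) (ub _ Xx0).
  apply: (@le_lt_trans _ _ (A + 1)%:E); last exact: ltry.
  by apply: ge_ereal_sup => _ [x Xx <-]; rewrite lee_fin bnd.
exists (fine (set_radius X)); rewrite fineK//; split => //.
  rewrite -lee_fin fineK//; apply: le_trans (ub _ Xx0).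
  by rewrite lee_fin l2norm_ge0.
by move=> x Xx; rewrite -lee_fin fineK// ub.
Qed.

End compact_radius.

(** * Identically distributed parameters *)

Section laws.
Context {dO : measure_display} {Omega : measurableType dO} {R : realType}.
Variable P : probability Omega R.
Context {dT : measure_display} {T : measurableType dT} {I : finType}.
Variables (mu : probability T R) (Y : I -> {RV P >-> T}).
Hypothesis Y_law : forall i A, measurable A -> distribution P (Y i) A = mu A.
Local Open Scope ereal_scope.

Lemma ae_law (Q : T -> Prop) : (\forall t \ae mu, Q t) ->
  \forall o \ae P, forall i, Q (Y i o).
Proof.
move=> [N [mN N0 QN]].
have Yi i : \forall o \ae P, Q (Y i o).
  exists (Y i @^-1` N); split.
  - by rewrite -[X in measurable X]setTI; exact: measurable_funPT.
  - by have := Y_law i mN; rewrite N0.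
  - by move=> o; exact: QN.
by apply: filter_forall => i; exact: Yi.
Qed.

Lemma integral_law (f : T -> \bar R) i j : measurable_fun [set: T] f ->
  (forall t, 0 <= f t) ->
  \int[P]_o f (Y i o) = \int[P]_o f (Y j o).
Proof.
move=> mf f0; rewrite -!ge0_integral_distribution//.
apply: eq_measure_integral => A mA _.
by transitivity (mu A); [exact: Y_law|exact/esym/Y_law].
Qed.

End laws.

(** * The bound on the Rademacher complexity *)

Unset Implicit Arguments.

Theorem proposition5p3
  (R : realType) (n d d1 : nat) (hd : (d1 <= d)%N)
  (X : set 'cV[R]_n) (hX : compact X)
  (dT : measure_display) (Theta : measurableType dT) (nu : probability Theta R)
  (* [t |-> (w t, b t)] is the inclusion of Theta in R^n x R = R^(n+1) *)
  (w : Theta -> 'cV[R]_n) (b : Theta -> R)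
  (hTheta : injective (fun t => (w t, b t)))
  (hw : mx_measurable w) (hb : measurable_fun [set: Theta] b)
  (Phi : 'cV[R]_n -> Theta -> 'M[R]_(d, d1))
  (phi : R -> R) (M : 'cV[R]_n -> 'M[R]_(d, d1))
  (hM : mx_measurable (M \o w))
  (hphi_lip : 1.-lipschitz phi)
  (hphi_bnd : forall s : R, -1 <= phi s <= 1)
  (hPhi : forall x t, Phi x t = phi (((w t)^T *m x) 0 0 + b t) *: M (w t))
  (BPhi : R -> R)
  (hBPhi : forall delta : R, 0 < delta < 1 ->
     (nu [set t | (opnorm (M (w t)) > BPhi delta)%R] <= delta%:E)%E)
  (Bh : R) (hBh : 0 < Bh)
  (h : 'cV[R]_n -> 'cV[R]_d) (hh : F2 nu Phi Bh h)
  (alpha : Theta -> 'cV[R]_d1) (halpha : F2_density nu Phi Bh alpha h)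
  (K : nat) (hK : (0 < K)%N)
  (dO : measure_display) (Omega : measurableType dO) (P : probability Omega R)
  (theta : 'I_K -> {RV P >-> Theta}) (htheta : iid nu theta)
  (eps : 'I_K -> {RV P >-> R})
  (heps : mutually_independent eps) (heps_rad : forall i, rademacher (eps i))
  (hindep : independent_families theta eps)
  (eta : R) (heta : 0 < eta < 1) :
  ((2 / K%:R)%:E *
     \int[P]_o supnorm X (fun x =>
        (\sum_(i < K) eps i o *:
           (trunc_feature M BPhi w b phi eta x (theta i o) *m alpha (theta i o)))%R)
   <= (4 * Bh * BPhi eta / Num.sqrt K%:R)%:E *
      (set_radius X * sqrte 'E_P[fun o => (l2norm (w (theta (Ordinal hK) o)) ^+ 2)%R]
       + (Num.sqrt d1%:R)%:E))%E.
Proof.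
have K0 : 0 < K%:R :> R by rewrite ltr0n.
have [X0|/set0P X0] := eqVneq X set0.
  (* The supremum over the empty set is -oo, and so is its integral. *)
  rewrite X0 (_ : (fun o => _) = cst -oo%E); last first.
    by apply/funext => o; rewrite /supnorm image_set0 ereal_sup0.
  rewrite integral_cst//= probability_setT mule1.
  by rewrite gt0_muleNy ?leNye// lte_fin divr_gt0.
have lip r t : `|phi r - phi t| <= `|r - t|.
  by have := hphi_lip (r, t) (conj Logic.I Logic.I); rewrite /= mul1r.
have bnd r : `|phi r| <= 1 by rewrite ler_norml hphi_bnd.
(* A negative value would be exceeded everywhere, with probability 1 > eta. *)
have BPhi0 : 0 <= BPhi eta.
  rewrite leNgt; apply/negP => B0.
  have := hBPhi _ heta; rewrite (_ : [set t | _] = setT); last first.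
    by apply/seteqP; split => // t _ /=; apply: lt_le_trans B0 (opnorm_ge0 _).
  by rewrite probability_setT lee_fin leNgt (andP heta).2.
case: halpha => malpha /ess_supP aealpha _.
case: htheta => _ law.
have [r [r0 -> Xr]] := set_radius_compact hX X0.
pose V := Bh * BPhi eta.
have V0 : 0 <= V by rewrite mulr_ge0// ltW.
pose S o := \sum_(i < K) l2norm (w (theta i o)) ^+ 2.
have mw2 : measurable_fun [set: Theta] (fun t => l2norm (w t) ^+ 2).
  by apply: measurable_funX; exact: measurable_l2norm.
have mS : measurable_fun [set: Omega] S.
  by apply: measurable_sum => i; exact: (measurableT_comp mw2).
have S0 o : 0 <= S o by apply: sumr_ge0 => i _; exact: sqr_ge0.
pose Nn := #|{ffun 'I_K -> bool}|%:R : R.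
have Nn0 : 0 < Nn by rewrite ltr0n; apply/card_gt0P; exists [ffun=> true].
pose sup_sum (e : 'I_K -> R) o : \bar R :=
  supnorm X (signed_sum w b phi M BPhi alpha eta e (theta^~ o)).
have sup_sum_ge0 e o : (0 <= sup_sum e o)%E.
  have [x Xx] := X0; apply: (@le_trans _ _
    (l2norm (signed_sum w b phi M BPhi alpha eta e (theta^~ o) x))%:E).
    by rewrite lee_fin l2norm_ge0.
  by apply: ereal_sup_ubound; exists x.
pose H (s : {ffun 'I_K -> bool}) := sup_sum (fun i => sgn_of (s i)).
(* For fixed signs the supremum depends on the parameters only. *)
have mH s : measurable_fun [set: g_sigma_algebraType (sigma_gen theta)]
      (H s : g_sigma_algebraType (sigma_gen theta) -> _).
  apply: (@measurable_supnorm_signed_sum _ _ _ _ _ _ w b phi M BPhi alpha eta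
    hw hb hM malpha lip _ (g_sigma_algebraType (sigma_gen theta)) _ X
    (fun i _ => sgn_of (s i)) theta) => // i.
  exact: measurable_sigma_gen.
have mF : measurable_fun [set: Omega] (fun o => sup_sum (eps^~ o) o).
  exact: (@measurable_supnorm_signed_sum _ _ _ _ _ _ w b phi M BPhi alpha eta
    hw hb hM malpha lip _ _ _ X (fun i => eps i) (fun i => theta i)).
rewrite (integral_signs heps heps_rad hindep mF (H := H))//; last 2 first.
- by move=> o; exact: sup_sum_ge0.
- move=> s o hs; rewrite /H /sup_sum; congr supnorm; apply/funext => x.
  by apply: eq_bigr => i _; rewrite hs.
pose C o := 2 * (V * r * Num.sqrt (S o) + V * (Num.sqrt d1%:R * Num.sqrt K%:R)).
have pointwise : \forall o \ae P, setT o ->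
    (\sum_s H s o <= (Nn * C o)%:E)%E.
  have := ae_law law aealpha; apply: filterS => o ho _.
  have aB i : l2norm (alpha (theta i o)) <= Bh by rewrite -lee_fin; exact: ho.
  have := sum_signs_supnorm_le w b M lip X0 Xr bnd (ltW hBh) BPhi0 aB.
  by rewrite card_ord.
have C0 o : 0 <= C o.
  rewrite /C mulr_ge0// addr_ge0//; last by rewrite mulr_ge0// mulr_ge0 ?sqrtr_ge0.
  by rewrite mulr_ge0 ?sqrtr_ge0// mulr_ge0.
have mC : measurable_fun [set: Omega] C.
  apply: measurable_funM => //; apply: measurable_funD => //.
  by apply: measurable_funM => //; exact: measurable_sqrt.
have mHO s : measurable_fun [set: Omega] (H s).
  exact: (@measurable_supnorm_signed_sum _ _ _ _ _ _ w b phi M BPhi alpha eta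
    hw hb hM malpha lip _ _ _ X (fun i _ => sgn_of (s i)) theta).
have sum_le : (\int[P]_o (\sum_s H s o) <=
    Nn%:E * \int[P]_o (C o)%:E)%E.
  rewrite -ge0_integralZl//; last 3 first.
  - exact/measurable_EFinP.
  - by move=> o _; rewrite lee_fin.
  - by rewrite lee_fin ltW.
  apply: ae_ge0_le_integral => //.
  - by move=> o _; apply: sume_ge0 => s _; exact: sup_sum_ge0.
  - exact: emeasurable_sum.
  - by move=> o _; rewrite -EFinM lee_fin mulr_ge0// ltW.
  - by apply: measurable_funeM; exact/measurable_EFinP.
set Ew := ('E_P[_])%E.
have mw2i i : measurable_fun [set: Omega]
    (fun o => (l2norm (w (theta i o)) ^+ 2)%:E).
  by apply/measurable_EFinP; exact: (measurableT_comp mw2).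
have ES : (\int[P]_o (S o)%:E = K%:R%:E * Ew)%E.
  rewrite /Ew unlock; under eq_integral do rewrite -sumEFin.
  rewrite ge0_integral_sum//; last by move=> i o _; rewrite lee_fin sqr_ge0.
  rewrite (eq_bigr (fun=> \int[P]_o (l2norm (w (theta (Ordinal hK) o)) ^+ 2)%:E)%E).
    by rewrite sumr_const card_ord mule_natl.
  move=> i _; apply: (@integral_law _ _ _ P _ _ _ nu theta law
    (fun t => (l2norm (w t) ^+ 2)%:E) i (Ordinal hK)).
    exact/measurable_EFinP.
  by move=> t; rewrite lee_fin sqr_ge0.
have Ew0 : (0 <= Ew)%E by apply: expectation_ge0 => o; exact: sqr_ge0.
have int_C_le : (\int[P]_o (C o)%:E <= (2 * V * Num.sqrt K%:R)%:E *
    (r%:E * sqrte Ew + (Num.sqrt d1%:R)%:E))%E.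
  have mC1 : measurable_fun [set: Omega]
      (fun o => (2 * V * r)%:E * (Num.sqrt (S o))%:E)%E.
    by apply: measurable_funeM; apply/measurable_EFinP; exact: measurable_sqrt.
  have Vr0 : 0 <= 2 * V * r by rewrite mulr_ge0// mulr_ge0.
  rewrite (_ : (fun o => (C o)%:E) = (fun o => (2 * V * r)%:E * (Num.sqrt (S o))%:E +
      (2 * V * (Num.sqrt d1%:R * Num.sqrt K%:R))%:E)%E); last first.
    by apply/funext => o; rewrite -EFinM -EFinD /C; congr EFin; ring.
  rewrite ge0_integralD//; last 2 first.
  - by move=> o _; rewrite -EFinM lee_fin mulr_ge0// sqrtr_ge0.
  - by move=> o _; rewrite lee_fin; apply: mulr_ge0; apply: mulr_ge0;
      rewrite ?sqrtr_ge0.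
  rewrite integral_cst//= probability_setT mule1.
  rewrite ge0_integralZl//; last by apply/measurable_EFinP; exact: measurable_sqrt.
  have rE0 : (0 <= r%:E * sqrte Ew)%E by rewrite mule_ge0// sqrte_ge0.
  rewrite [leRHS]ge0_muleDr//.
  apply: leeD; last first.
    by rewrite -EFinM lee_fin le_eqVlt; apply/orP; left; apply/eqP; ring.
  apply: le_trans (lee_wpmul2l _ (integral_sqrt_le P mS S0)) _.
    by rewrite lee_fin.
  rewrite ES sqrteM ?lee_fin ?ler0n//= !muleA -!EFinM.
  by rewrite le_eqVlt; apply/orP; left; apply/eqP; congr (_%:E * _)%E; ring.
apply: le_trans (lee_wpmul2l _ (lee_wpmul2l _
  (le_trans sum_le (lee_wpmul2l _ int_C_le)))) _.
- by rewrite lee_fin divr_ge0.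
- by rewrite lee_fin invr_ge0 ler0n.
- by rewrite lee_fin ltW.
rewrite !muleA -!EFinM le_eqVlt; apply/orP; left; apply/eqP.
congr (_%:E * _)%E; rewrite -/Nn.
have sK0 : Num.sqrt K%:R != 0 :> R by rewrite sqrtr_eq0 -ltNge.
rewrite -[X in _ / X](sqr_sqrtr (ltW K0)) /V.
by field; rewrite sK0 gt_eqF.
Qed.
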